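(* Let $0\le m\le n-2$ and let $e_1,\ldots,e_n$ be an orthonormal basis of $\mathbb{R}^n$. Let $F(t,\mathbf{u},\mathbf{v})$ be a real polynomial in $t\in\mathbb{R}$, $\mathbf{u},\mathbf{v}\in\mathbb{R}^m$, which is symmetric in $\mathbf{u},\mathbf{v}$, i.e. $F(t,\mathbf{u},\mathbf{v})=F(t,\mathbf{v},\mathbf{u})$. Suppose $F\in\mathrm{PD}(\mathbb{S}^{n-1},\{e_1,\ldots,e_m\})$. Then $$F(t,\mathbf{u},\mathbf{v})=\sum_{k=0}^d f_k(\mathbf{u},\mathbf{v})\,G_k^{(n,m)}(t,\mathbf{u},\mathbf{v}),$$ where $d=\deg_t(F)$ and $f_k(\mathbf{u},\mathbf{v})$ are symmetric polynomials with $f_k\succeq0$ for all $0\le k\le d$.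
   Context: $\langle\cdot,\cdot\rangle$ and $|\cdot|$ denote the Euclidean inner product and norm; $\mathbb{S}^{n-1}$ is the unit sphere of $\mathbb{R}^n$. For an integer $n\ge2$, the Gegenbauer polynomials $G_k^{(n)}(t)$ (normalized by $G_k^{(n)}(1)=1$) are given by $G_0^{(n)}=1$, $G_1^{(n)}=t$, and for $k\ge2$ $$G_k^{(n)}=\frac{(2k+n-4)\,t\,G_{k-1}^{(n)}-(k-1)\,G_{k-2}^{(n)}}{k+n-3}.$$ For $0\le m\le n-2$, $t\in\mathbb{R}$, $\mathbf{u},\mathbf{v}\in\mathbb{R}^m$ (with $\mathbf{u}=\mathbf{v}=0$ if $m=0$), the multivariate Gegenbauer polynomial is $$G_k^{(n,m)}(t,\mathbf{u},\mathbf{v}):=(1-|\mathbf{u}|^2)^{k/2}(1-|\mathbf{v}|^2)^{k/2}\,G_k^{(n-m)}\!\left(\frac{t-\langle\mathbf{u},\mathbf{v}\rangle}{\sqrt{(1-|\mathbf{u}|^2)(1-|\mathbf{v}|^2)}}\right),$$ understood as the polynomial in $2m+1$ variables that this expression defines: if $G_k^{(n-m)}(s)=\sum_j a_j s^{k-2j}$, then $G_k^{(n,m)}(t,\mathbf{u},\mathbf{v})=\sum_j a_j (t-\langle\mathbf{u},\mathbf{v}\rangle)^{k-2j}\bigl((1-|\mathbf{u}|^2)(1-|\mathbf{v}|^2)\bigr)^{j}$. The class $\mathrm{PD}(\mathbb{S}^{n-1},\{q_1,\ldots,q_m\})$: a continuous function $F(t,\mathbf{u},\mathbf{v})$ with $F(t,\mathbf{u},\mathbf{v})=F(t,\mathbf{v},\mathbf{u})$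 belongs to it if for every $r$ and all $p_1,\ldots,p_r\in\mathbb{S}^{n-1}$ the matrix $\bigl(F(t_{ij},\mathbf{u}_i,\mathbf{u}_j)\bigr)_{i,j=1}^r$ is positive semidefinite, where $t_{ij}=\langle p_i,p_j\rangle$ and $\mathbf{u}_i=(\langle p_i,q_1\rangle,\ldots,\langle p_i,q_m\rangle)$. Positive semidefinite polynomials: let $z_d^m(\mathbf{x})$ be the row vector of all monomials of degree at most $d$ in $x_1,\ldots,x_m$, and $Z_d^m(\mathbf{u},\mathbf{v})=z_d^m(\mathbf{u})^T z_d^m(\mathbf{v})$, a matrix of size $\binom{m+d}{d}$ (for $m=0$ it is the $1\times1$ matrix $(1)$). A symmetric polynomial $f(\mathbf{u},\mathbf{v})=f(\mathbf{v},\mathbf{u})$ is called positive semidefinite, $f\succeq0$, if there are $d\ge0$ and a symmetric positive semidefinite matrix $H$ with $f(\mathbf{u},\mathbf{v})=\langle H,Z_d^m(\mathbf{u},\mathbf{v})\rangle$, where $\langle A,B\rangle=\sum_{i,j}a_{ij}b_{ij}$. (For $F=0$ read $\deg_t(F)=0$.) *)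

(* Defs.v *)
From HB Require Import structures.
From mathcomp Require Import all_boot all_order all_algebra.
(* mpoly has to be imported before the topology files: the two clash on a
   notation level in the other order. *)
From mathcomp Require Import mpoly.
From mathcomp Require Import reals topology normedtype.

Set Implicit Arguments.
Unset Strict Implicit.
Unset Printing Implicit Defensive.

Import Order.TTheory GRing.Theory Num.Theory.
Import numFieldTopology.Exports.

Local Open Scope ring_scope.

Section Euclidean.

Variable R : realType.

(* The library norm on 'rV[R]_n is the sup norm, hence [enorm]. *)
Definition dot n (x y : 'rV[R]_n) : R := \sum_(i < n) x 0 i * y 0 i.
Definition enorm n (x : 'rV[R]_n) : R := Num.sqrt (dot x x).

Definition orthonormal_basis n (e : 'I_n -> 'rV[R]_n) : Prop :=
  basis_of fullv [tuple e i | i < n] /\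
  forall i j, dot (e i) (e j) = (i == j)%:R.

Definition psdmx r (A : 'M[R]_r) : Prop :=
  A^T = A /\ forall x : 'rV[R]_r, 0 <= (x *m A *m x^T) 0 0.

(* The class PD(S^(n-1), {q_1, ..., q_m}). *)
Definition PD n m (q : 'I_m -> 'rV[R]_n)
    (F : R -> 'rV[R]_m -> 'rV[R]_m -> R) : Prop :=
  [/\ continuous (fun x : R * 'rV[R]_m * 'rV[R]_m => F x.1.1 x.1.2 x.2),
      (forall t u v, F t u v = F t v u)
    & forall (r : nat) (p : 'I_r -> 'rV[R]_n),
        (forall i, enorm (p i) = 1) ->
        let u i : 'rV[R]_m := \row_(k < m) dot (p i) (q k) in
        psdmx (\matrix_(i < r, j < r) F (dot (p i) (p j)) (u i) (u j))].

End Euclidean.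

Section Polynomials.

Variable R : realType.

(* A polynomial in (u, v) is an element of {mpoly R[m + m]}: u_i is the variable
   of index [lshift m i] and v_i that of index [rshift m i]. A polynomial in
   (t, u, v) is an element of {poly {mpoly R[m + m]}}, with t = 'X. *)
Definition ueval m (f : {mpoly R[m + m]}) (u v : 'rV[R]_m) : R :=
  f.@[fun i => row_mx u v 0 i].

Definition tueval m (F : {poly {mpoly R[m + m]}}) (t : R) (u v : 'rV[R]_m) : R :=
  (map_poly (fun f => ueval f u v) F).[t].

Definition deg_t m (F : {poly {mpoly R[m + m]}}) : nat := (size F).-1.

Definition uvar m (i : 'I_m) : {mpoly R[m + m]} := 'X_(lshift m i).
Definition vvar m (i : 'I_m) : {mpoly R[m + m]} := 'X_(rshift m i).

(* The row of all monomials of degree at most d in m variables, at the point x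
   of a commutative ring S; the entries are indexed by an enumeration of the
   multi-indices of total degree < d.+1. *)
Definition zmon (S : comNzRingType) m d (x : 'I_m -> S) :
    'rV[S]_#|{: 'X_{1..m < d.+1}}| :=
  \row_k mmap1 x (enum_val k : 'X_{1..m < d.+1}).

Definition Zmx m d : 'M[{mpoly R[m + m]}]_#|{: 'X_{1..m < d.+1}}| :=
  (zmon d (@uvar m))^T *m zmon d (@vvar m).

Definition psd_poly m (f : {mpoly R[m + m]}) : Prop :=
  (forall u v : 'rV[R]_m, ueval f u v = ueval f v u) /\
  exists (d : nat) (H : 'M[R]_#|{: 'X_{1..m < d.+1}}|),
    psdmx H /\ f = \sum_i \sum_j H i j *: Zmx m d i j.

Fixpoint gegenbauer (n k : nat) : {poly R} :=
  match k with
  | 0 => 1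
  | k1.+1 =>
    if k1 is k2.+1 then
      (k%:R + n%:R - 3%:R)^-1 *:
        (((2 * k)%:R + n%:R - 4%:R) *: ('X * gegenbauer n k1)
         - (k%:R - 1) *: gegenbauer n k2)
    else 'X
  end.

Definition uv m : {mpoly R[m + m]} := \sum_(i < m) uvar i * vvar i.
Definition uu m : {mpoly R[m + m]} := \sum_(i < m) uvar i ^+ 2.
Definition vv m : {mpoly R[m + m]} := \sum_(i < m) vvar i ^+ 2.

(* The polynomial form of G_k^(n,m): G_k^(n-m) only has monomials s^(k-2j), and
   a_j is its coefficient of s^(k-2j). *)
Definition mgegenbauer (n m k : nat) : {poly {mpoly R[m + m]}} :=
  \sum_(j < (k./2).+1)
    (((gegenbauer (n - m) k)`_(k - j.*2))%:MP *: ('X - (uv m)%:P) ^+ (k - j.*2))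
    * (((1 - uu m) * (1 - vv m)) ^+ j)%:P.

End Polynomials.

(* Main.v *)
Require Import Defs.
From HB Require Import structures.
From mathcomp Require Import all_boot all_order all_algebra.
From mathcomp Require Import mpoly.
From mathcomp Require Import reals topology normedtype.
From mathcomp Require Import qpoly ring zify.

Set Implicit Arguments.
Unset Strict Implicit.
Unset Printing Implicit Defensive.

Import Order.TTheory GRing.Theory Num.Theory.
Local Open Scope ring_scope.

(** Write N for n - m. A unit vector of R^n whose first m coordinates are u,
    with |u| < 1, has the form (u, r y) with r = sqrt (1 - |u|^2) and y on the
    unit sphere of R^N, and for two such vectors
      t = <u, u'> + r r' <y, y'>.
    Since G_k^(n,m) has degree k in t with a nonzero constant as leading
    coefficient, F is a combination of these polynomials, with coefficients
    f_k(u, v) that are unique, hence symmetric ([mgegenbauer_expansion],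
    [expansion_sym]); at the points above it becomes
      F = \sum_k f_k(u, u') (r r')^k G_k^(N)(<y, y'>)   ([tueval_expansion]).

    The difficulty is to isolate f_k. The classical proof integrates against
    the zonal harmonic of degree k. Here the integral is replaced by finitely
    many points y_s of the sphere with real weights b_s, of arbitrary sign,
    such that for all l <= d
      \sum_(s, s') b_s b_s' G_l(<y_s, y_s'>) = 1 if l = k, and 0 otherwise
    ([spherical_projector]). Applying the hypothesis on F to the points
    (u_i, r_i y_s) with weights c_i r_i^-k b_s then shows that f_k is a positive
    semidefinite kernel on the open unit ball ([coefficient_psd]). The
    weights may have any sign, since they only multiply the coefficients of a
    quadratic form.

    The weights come from the Laplacian of the sphere. The functions
    x |-> G_l(<x, y>), for y fixed, are eigenfunctions of it with eigenvalues
    - l (l + N - 2), distinct for distinct l. On polynomials of degree at most d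
    the Laplacian is a finite combination of rotations: it is the sum over the
    coordinate planes of second derivatives along rotations, and a derivative
    of a polynomial of bounded degree is a combination of its values
    ([interpolate_functional]). So a polynomial in the Laplacian, in particular
    the projector onto the eigenspace of degree k, is such a combination too
    ([multiplier_laplacian], [multiplier_delta]).

    It remains to pass from the kernel f_k to its coefficient matrix H
    ([psd_poly_of_kernel]). The functionals taking a coefficient of a polynomial
    in m variables of bounded degree are combinations of values at the points of
    a grid, which can be placed inside the ball ([dual_grid]). Hence H is
    obtained from the kernel by a congruence: it is symmetric and positive
    semidefinite. *)

(** * Linear functionals as combinations of values *)

(** Polynomials of degree less than [n] are determined by their values at [n]
    points, so every linear functional on them is a combination of these
    values. It is used for a derivative at 1 and for the coefficients. *)
Lemma interpolate_functional (K : fieldType) (c : nat -> K) (n : nat)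
    (L : {scalar {poly K}}) :
  injective c ->
  exists b : 'I_n -> K, forall p : {poly K}, (size p <= n)%N ->
    L p = \sum_(s < n) b s * p.[c s].
Proof.
move=> c_inj; case: n => [|n].
  exists (fun=> 0) => p; rewrite leqn0 size_poly_eq0 => /eqP->.
  by rewrite linear0 big_ord0.
exists (fun s => L (tnth (lagrange n.+1 c) s)) => p sz_p.
rewrite {1}(lagrange_gen (isT : 0 < n.+1)%N c_inj sz_p) linear_sum.
by apply: eq_bigr => s _; rewrite mul_polyC linearZ /= mulrC.
Qed.

Section Nodes.
Variable R : realType.

(** Distinct positive points, at most 1 / (m + 1), so that all points of R^m
    with such coordinates lie in the open unit ball. *)
Definition node (m s : nat) : R := (s + m.+1)%:R^-1.

Lemma node_inj m : injective (node m).
Proof. by move=> s s' /invr_inj /eqP; rewrite eqr_nat eqn_add2r => /eqP. Qed.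

Lemma node_gt0 m s : 0 < node m s.
Proof. by rewrite invr_gt0 ltr0n addnS. Qed.

Lemma node_le m s : node m s <= m.+1%:R^-1.
Proof. by rewrite lef_pV2 ?posrE ?ltr0n ?addnS // ler_nat ltnS leq_addl. Qed.

End Nodes.

(** * Gegenbauer polynomials *)

Section Gegenbauer.

Variables (R : realType) (N : nat).
Local Notation G := (gegenbauer R N.+2).

Lemma natr_poly_neq0 k : k.+1%:R != 0 :> {poly R}.
Proof. by rewrite -polyC_natr polyC_eq0 pnatr_eq0. Qed.

(** The defining recurrence with its denominator cleared and integer factors, so
    that [ring] can use it in [{poly R}]. The dimension is [N.+2]. *)
Lemma gegenbauer_rec k :
  (k.+1 + N)%:R * G k.+2 =
  (2 * k.+1 + N)%:R * 'X * G k.+1 - k.+1%:R * G k.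
Proof.
have E1 : k.+2%:R + N.+2%:R - 3%:R = (k.+1 + N)%:R :> R by ring.
have E2 : (2 * k.+2)%:R + N.+2%:R - 4%:R = (2 * k.+1 + N)%:R :> R by ring.
have E3 : k.+2%:R - 1 = k.+1%:R :> R by ring.
have -> : G k.+2 = (k.+2%:R + N.+2%:R - 3%:R)^-1 *:
   (((2 * k.+2)%:R + N.+2%:R - 4%:R) *: ('X * G k.+1)
         - (k.+2%:R - 1) *: G k) by [].
rewrite E1 E2 E3 mulr_natl -scaler_nat scalerA mulfV ?pnatr_eq0 // scale1r.
by rewrite !scaler_nat -mulrA !mulr_natl.
Qed.

Lemma gegenbauer_at1 k : (G k).[1] = 1.
Proof.
suff [] : (G k).[1] = 1 /\ (G k.+1).[1] = 1 by [].
elim: k => [|k [IH0 IH1]]; first by rewrite /= !hornerE.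
split=> //; have nz : (k.+1 + N)%:R != 0 :> R by rewrite pnatr_eq0.
move: (gegenbauer_rec k) IH0 IH1; move: (G k) (G k.+1) (G k.+2) => g0 g1 g2.
move=> /(congr1 (fun p => p.[1])) + IH0 IH1.
rewrite !hornerE -!polyC_natr !hornerC IH0 IH1 => E.
apply: (mulfI nz); rewrite E; ring.
Qed.

Lemma size_gegenbauer k : (size (G k) <= k.+1)%N.
Proof.
suff [] : (size (G k) <= k.+1)%N /\ (size (G k.+1) <= k.+2)%N by [].
elim: k => [|k [IH0 IH1]]; first by rewrite /= size_poly1 size_polyX.
split=> //; have nz : (k.+1 + N)%:R != 0 :> R by rewrite pnatr_eq0.
move: (gegenbauer_rec k) IH0 IH1; move: (G k) (G k.+1) (G k.+2) => g0 g1 g2.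
move=> gegenbauer_rec IH0 IH1.
rewrite -(size_scale _ nz) scaler_nat -mulr_natl gegenbauer_rec.
apply: leq_trans (size_polyD _ _) _; rewrite size_polyN geq_max -mulrA.
rewrite !mulr_natl -!scaler_nat.
apply/andP; split; apply: leq_trans (size_scale_leq _ _) _;
  last by exact: leqW (leqW IH0).
rewrite mulrC; apply: leq_trans (size_polyMleq _ _) _.
by rewrite size_polyX addn2.
Qed.

Lemma coef_gegenbauer_neq0 k : (G k)`_k != 0.
Proof.
suff [] : (G k)`_k != 0 /\ (G k.+1)`_k.+1 != 0 by [].
elim: k => [|k [IH0 IH1]].
  by rewrite /= coefX coefC /= oner_eq0.
split=> //.
have sz0 := size_gegenbauer k.
move: (gegenbauer_rec k) IH0 IH1 sz0; move: (G k) (G k.+1) (G k.+2) => g0 g1 g2.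
move=> /(congr1 (fun p : {poly R} => p`_k.+2)) + IH0 IH1 sz0.
rewrite -mulrA !mulr_natl coefB !coefMn coefXM /=.
rewrite (nth_default _ (leq_trans sz0 _)) ?mul0rn ?subr0 // => E.
have : g2`_k.+2 *+ (k.+1 + N) != 0 by rewrite E mulrn_eq0 negb_or.
by rewrite mulrn_eq0 negb_or => /andP[].
Qed.

Lemma gegenbauer_parity k i : odd (k + i) -> (G k)`_i = 0.
Proof.
suff [] : (forall i, odd (k + i) -> (G k)`_i = 0) /\
          (forall i, odd (k.+1 + i) -> (G k.+1)`_i = 0) by move=> H _; apply: H.
elim: k {i} => [|k [IH0 IH1]].
  by rewrite /=; split; case=> [|[|i]] //; rewrite ?coefX ?coefC.
split=> // i odd_i.
move: (gegenbauer_rec k) IH0 IH1; move: (G k) (G k.+1) (G k.+2) => g0 g1 g2.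
move=> /(congr1 (fun p : {poly R} => p`_i)) + IH0 IH1.
rewrite -mulrA !mulr_natl coefB !coefMn coefXM.
rewrite IH0; last by move: odd_i; rewrite !addSn /= negbK.
have -> : (if (i == 0)%N then 0 else g1`_i.-1) = 0.
  case: i odd_i => [|i] odd_i //=; apply: IH1.
  by move: odd_i; rewrite !addSn !addnS /= !negbK.
by rewrite !mul0rn subr0 => /eqP; rewrite mulrn_eq0 => /eqP.
Qed.

(** The first-order relation that turns the recurrence, which has no
    derivatives, into the differential equation: it propagates along the
    recurrence, and differentiating it once more gives [gegenbauer_ode]. *)
Lemma gegenbauer_deriv k :
  (1 - 'X ^+ 2) * (G k.+1)^`() = k.+1%:R * (G k - 'X * G k.+1).
Proof.
suff [] : (1 - 'X ^+ 2) * (G k)^`() = k%:R * (G k.-1 - 'X * G k) /\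
  (1 - 'X ^+ 2) * (G k.+1)^`() = k.+1%:R * (G k - 'X * G k.+1) by [].
elim: k => [|k [IH0 IH1]].
  by rewrite /= !derivE; split=> //; ring.
split=> //.
apply: (mulfI (natr_poly_neq0 (k + N))); rewrite -addSn.
have E : (k + N)%:R * G k.+1 = (2 * k + N)%:R * 'X * G k - k%:R * G k.-1.
  case: k {IH0 IH1} => [|k]; last exact: gegenbauer_rec.
  by rewrite muln0 mul0r subr0 mulr1.
(* The polynomials are made variables, lest they be unfolded. *)
move: (gegenbauer_rec k) IH0 IH1 E.
move: (G k) (G k.+1) (G k.+2) (G k.-1) => g0 g1 g2 gm H IH0 IH1 E.
have D : (k.+1 + N)%:R * g2^`() =
  (2 * k.+1 + N)%:R * (g1 + 'X * g1^`()) - k.+1%:R * g0^`().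
  have /(congr1 (@deriv _)) := H.
  rewrite -mulrA !mulr_natl derivB !derivMn derivM derivX mul1r => ->.
  by rewrite addrC.
have -> : (k.+1 + N)%:R * ((1 - 'X ^+ 2) * g2^`()) =
  (2 * k.+1 + N)%:R * ((1 - 'X ^+ 2) * g1 + 'X * ((1 - 'X ^+ 2) * g1^`()))
  - k.+1%:R * ((1 - 'X ^+ 2) * g0^`()).
  have -> : (k.+1 + N)%:R * ((1 - 'X ^+ 2) * g2^`()) =
    (1 - 'X ^+ 2) * ((k.+1 + N)%:R * g2^`()) by ring.
  rewrite D; ring.
rewrite IH0 IH1.
have -> : (k.+1 + N)%:R * (k.+2%:R * (g1 - 'X * g2)) =
  k.+2%:R * ((k.+1 + N)%:R * g1 - 'X * ((k.+1 + N)%:R * g2)) by ring.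
rewrite H.
apply/eqP; rewrite -subr_eq0; apply/eqP.
transitivity (- k.+1%:R * ((k + N)%:R * g1 -
   ((2 * k + N)%:R * 'X * g0 - k%:R * gm))); last by rewrite E; ring.
ring.
Qed.

(** The left-hand side is the Laplacian of the sphere acting on a function of
    t = <x, y>. The identity is proved after multiplication by 1 - t^2, where
    [gegenbauer_deriv] removes every derivative. *)
Lemma gegenbauer_ode k :
  (1 - 'X ^+ 2) * (G k)^`(2) - N.+1%:R * 'X * (G k)^`() =
  - (k * (k + N))%:R * G k.
Proof.
case: k => [|k].
  have -> : G 0 = 1%:P by rewrite polyC1.
  by rewrite derivnC derivC  !mulr0 subrr mul0n oppr0 mul0r.
have nz : 1 - 'X ^+ 2 != 0 :> {poly R}.
  apply/eqP => /(congr1 (fun p : {poly R} => p.[0])).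
  by rewrite !hornerE expr0n subr0 => /eqP; rewrite oner_eq0.
have E : (k + N)%:R * G k.+1 = (2 * k + N)%:R * 'X * G k - k%:R * G k.-1.
  case: k => [|k]; last exact: gegenbauer_rec.
  by rewrite muln0 mul0r subr0 mulr1.
have D0 : (1 - 'X ^+ 2) * (G k)^`() = k%:R * (G k.-1 - 'X * G k).
  case: k {E} => [|k]; last exact: gegenbauer_deriv.
  by rewrite /= -[1%R]/(1%:P) derivC mulr0 mul0r.
move: (gegenbauer_deriv k) E D0.
rewrite derivSn derivn1; move: (G k) (G k.+1) (G k.-1) => g0 g1 gm D1 E D0.
have D2 : (1 - 'X ^+ 2) * g1^`()^`() =
  2%:R * 'X * g1^`() + k.+1%:R * (g0^`() - (g1 + 'X * g1^`())).
  have := congr1 (@deriv _) D1.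
  rewrite !mulr_natl derivMn derivB !derivM derivB derivXn derivC derivX => E2.
  have -> : (1 - 'X ^+ 2) * g1^`()^`() =
   (0 - 'X *+ 2) * g1^`() + (1 - 'X ^+ 2) * g1^`()^`() + 2%:R * 'X * g1^`()
    by ring.
  rewrite /= expr1 in E2.
  rewrite E2; ring.
apply: (mulfI nz).
have -> : (1 - 'X ^+ 2) * ((1 - 'X ^+ 2) * g1^`()^`() - N.+1%:R * 'X * g1^`()) =
  (1 - 'X ^+ 2) * ((1 - 'X ^+ 2) * g1^`()^`()) -
  N.+1%:R * 'X * ((1 - 'X ^+ 2) * g1^`()) by ring.
rewrite D2.
have -> : (1 - 'X ^+ 2) * (2%:R * 'X * g1^`() +
    k.+1%:R * (g0^`() - (g1 + 'X * g1^`()))) =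
  2%:R * 'X * ((1 - 'X ^+ 2) * g1^`()) + k.+1%:R *
  ((1 - 'X ^+ 2) * g0^`() - ((1 - 'X ^+ 2) * g1 +
    'X * ((1 - 'X ^+ 2) * g1^`()))) by ring.
rewrite D1 D0.
apply/eqP; rewrite -subr_eq0; apply/eqP.
transitivity (k.+1%:R * ((k + N)%:R * g1 -
   ((2 * k + N)%:R * 'X * g0 - k%:R * gm))); last by rewrite E; ring.
ring.
Qed.

End Gegenbauer.

(** * Inner products and plane rotations *)

Section Dot.
Variables (R : realType) (n : nat).
Implicit Types x y z : 'rV[R]_n.

Lemma dotC x y : dot x y = dot y x.
Proof. by apply: eq_bigr => i _; rewrite mulrC. Qed.

Lemma dotDr x y z : dot x (y + z) = dot x y + dot x z.
Proof. by rewrite -big_split; apply: eq_bigr => i _; rewrite mxE mulrDr. Qed.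

Lemma dotZr a x y : dot x (a *: y) = a * dot x y.
Proof. by rewrite mulr_sumr; apply: eq_bigr => i _; rewrite mxE mulrCA. Qed.

Lemma dotNr x y : dot x (- y) = - dot x y.
Proof. by rewrite -scaleN1r dotZr mulN1r. Qed.

Lemma dotZl a x y : dot (a *: y) x = a * dot y x.
Proof. by rewrite dotC dotZr (dotC x). Qed.

Lemma dot_delta x i : dot x (delta_mx 0 i) = x 0 i.
Proof.
rewrite /dot (bigD1 i) //= mxE !eqxx mulr1 big1 ?addr0 // => j ji.
by rewrite mxE (negPf ji) mulr0.
Qed.

(** [c] and [s] stand for the cosine and the sine of the angle; the formula is a
    rotation when [c ^+ 2 + s ^+ 2 = 1]. *)
Definition plane_rotation (i j : 'I_n) (c s : R) y : 'rV[R]_n :=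
  y + (c - 1) *: (y 0 i *: delta_mx 0 i + y 0 j *: delta_mx 0 j)
    + s *: (y 0 i *: delta_mx 0 j - y 0 j *: delta_mx 0 i).

Lemma dot_plane_rotation i j c s x y :
  dot x (plane_rotation i j c s y) =
  dot x y + (c - 1) * (x 0 i * y 0 i + x 0 j * y 0 j)
    + s * (x 0 j * y 0 i - x 0 i * y 0 j).
Proof. by rewrite !(dotDr, dotZr, dotNr, dot_delta); ring. Qed.

Lemma plane_rotation_unit i j c s y : i != j -> c ^+ 2 + s ^+ 2 = 1 ->
  dot y y = 1 -> dot (plane_rotation i j c s y) (plane_rotation i j c s y) = 1.
Proof.
move=> ij cs yy; rewrite dot_plane_rotation.
rewrite dotC dot_plane_rotation yy !mxE !eqxx (eq_sym j) (negPf ij) /=.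
transitivity (1 + (y 0 i ^+ 2 + y 0 j ^+ 2) * (c ^+ 2 + s ^+ 2 - 1)).
  by ring.
by rewrite cs subrr mulr0 addr0.
Qed.

End Dot.

Section Rotation.
Variable R : comNzRingType.

(** The left-hand side of the third item is the value of [g] at <x, y'>, where
    y' is the rotation of y in a coordinate plane (see [dot_plane_rotation]).
    As s^2 = 1 - c^2 it is p(c) + s q(c), so the average over the angles
    +theta and -theta is the polynomial p in c. Since c = 1 - theta^2 / 2 + ...,
    the number - p'(1) is the second derivative at theta = 0. *)
Lemma rotation_decomp (a b t : R) (n : nat) (g : {poly R}) :
  (size g <= n)%N ->
  exists pq : {poly R} * {poly R},
  [/\ (size pq.1 <= n)%N, (size pq.2 <= n.-1)%N,
      (forall c s, c ^+ 2 + s ^+ 2 = 1 ->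
         g.[t + (c - 1) * a + s * b] = pq.1.[c] + s * pq.2.[c]),
      pq.1.[1] = g.[t] /\ pq.2.[1] = b * g^`().[t]
    & pq.1^`().[1] = a * g^`().[t] - b ^+ 2 * g^`(2).[t]].
Proof.
elim: n g => [|n IH] g.
  rewrite leqn0 size_poly_eq0 => /eqP->; exists (0, 0).
  split; rewrite /= ?size_poly0 //; rewrite ?linear0 ?horner0 ?mulr0 ?subr0 //.
  by move=> c s _; rewrite !horner0 mulr0 addr0.
elim/poly_ind: g => [|g e _] sz_g.
  exists (0, 0); split; rewrite /= ?size_poly0 //;
    rewrite ?linear0 ?horner0 ?mulr0 ?subr0 //.
  by move=> c s _; rewrite !horner0 mulr0 addr0.
have sg : (size g <= n)%N.
  move: sz_g; rewrite size_MXaddC; case: ifP => //.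
  by move=> /andP[/eqP-> _]; rewrite size_poly0.
have [[p q] /= [sp sq E [p1 q1] dp1]] := IH g sg.
exists ((t - a)%:P * p + a%:P * (p * 'X) + b%:P * q - b%:P * (q * 'X^2) + e%:P,
        (t - a)%:P * q + a%:P * (q * 'X) + b%:P * p).
have sC (x : R) (r : {poly R}) k : (size r <= k)%N ->
    (size (x%:P * r)%R <= k)%N.
  by move=> sr; rewrite mul_polyC; apply: leq_trans (size_scale_leq _ _) sr.
have sX (r : {poly R}) k : (size r <= k)%N -> (size (r * 'X)%R <= k.+1)%N.
  by move=> sr; apply: leq_trans (size_polyMleq _ _) _; rewrite size_polyX addn2.
have sD (r r' : {poly R}) k : (size r <= k)%N -> (size r' <= k)%N ->
    (size (r + r')%R <= k)%N.
  by move=> sr sr'; apply: leq_trans (size_polyD _ _) _; rewrite geq_max sr.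
split=> /=.
- apply: (sD); last by apply: leq_trans (size_polyC_leq1 _) _.
  apply: (sD); last first.
    rewrite size_polyN; apply: (sC); have [->|nz_q] := eqVneq q 0.
      by rewrite mul0r size_poly0.
    apply: leq_trans (size_polyMleq _ _) _; rewrite size_polyXn addn3 /= ltnS.
    by case: n sq {IH sg sz_g sp} => [|n];
      rewrite ?leqn0 ?size_poly_eq0 ?(negPf nz_q).
  apply: (sD); last first.
    by apply: (sC); apply: leq_trans sq _; rewrite (leq_trans (leq_pred _)).
  apply: (sD); first by apply: (sC); apply: leq_trans sp _.
  by apply/sC/sX.
- apply: (sD); last by apply: (sC).
  apply: (sD); first by apply: (sC); apply: leq_trans sq _; apply: leq_pred.
  apply: (sC); case: n sq {IH sg sz_g sp} => [|n] sq; last exact: sX.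
  by move: sq; rewrite /= leqn0 size_poly_eq0 => /eqP->; rewrite mul0r size_poly0.
- move=> c s cs; rewrite hornerMXaddC E //.
  rewrite !(hornerD, hornerN, hornerM, hornerX, hornerC, hornerXn).
  have Z : b * q.[c] * (c ^+ 2 + s ^+ 2 - 1) = 0 by rewrite cs subrr mulr0.
  rewrite -[RHS]addr0 -Z.
  ring.
- rewrite derivD derivM derivX derivC.
  rewrite !(hornerD, hornerN, hornerM, hornerX, hornerC, hornerXn) p1 q1.
  by split; ring.
- rewrite !(derivD, derivN, derivM, derivX, derivC, derivXn) /=.
  rewrite !(hornerD, hornerN, hornerM, hornerX, hornerC, hornerXn).
  rewrite p1 q1 dp1; ring.
Qed.
End Rotation.

(** * Finite combinations of points of the sphere *)

Section SphereCombinations.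

Variables (R : realType) (N d : nat).
Local Notation V := 'rV[R]_N.+2.
Local Notation G := (gegenbauer R N.+2).

Definition sphere_comb (mu : seq (R * V)) (phi : V -> R) : R :=
  \sum_(z <- mu) z.1 * phi z.2.

Definition on_sphere (mu : seq (R * V)) := forall z, z \in mu -> dot z.2 z.2 = 1.

(** The functions of degree [l <= d] on the sphere spanned by the
    x |-> G_l(<x, y>) are all tested at once: one list of weighted points must
    serve for every [l]. *)
Definition representable (Phi : V -> nat -> R) : Prop :=
  exists2 mu, on_sphere mu & forall x l, dot x x = 1 -> (l <= d)%N ->
    sphere_comb mu (fun y => (G l).[dot x y]) = Phi x l.

Lemma eq_representable Phi Psi :
  (forall x l, dot x x = 1 -> (l <= d)%N -> Phi x l = Psi x l) ->
  representable Phi -> representable Psi.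
Proof.
by move=> E [mu mu1 H]; exists mu => // x l x1 ld; rewrite H // E.
Qed.

Lemma representable_point y : dot y y = 1 ->
  representable (fun x l => (G l).[dot x y]).
Proof.
move=> y1; exists [:: (1, y)]; first by move=> z; rewrite inE => /eqP->.
by move=> x l _ _; rewrite /sphere_comb big_seq1 mul1r.
Qed.

Lemma representable0 : representable (fun _ _ => 0).
Proof. by exists [::] => // x l _ _; rewrite /sphere_comb big_nil. Qed.

Lemma representableD Phi Psi : representable Phi -> representable Psi ->
  representable (fun x l => Phi x l + Psi x l).
Proof.
move=> [mu mu1 H] [nu nu1 K]; exists (mu ++ nu).
  by move=> z; rewrite mem_cat => /orP[/mu1|/nu1].
by move=> x l x1 ld; rewrite /sphere_comb big_cat /= -H // -K.
Qed.

Lemma representableZ a Phi : representable Phi ->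
  representable (fun x l => a * Phi x l).
Proof.
move=> [mu mu1 H]; exists [seq (a * z.1, z.2) | z <- mu].
  by move=> _ /mapP[z /mu1 ? ->].
move=> x l x1 ld; rewrite /sphere_comb big_map -H // mulr_sumr.
by apply: eq_bigr => z _; rewrite mulrA.
Qed.

Lemma representable_sum (I : eqType) (r : seq I) (P : pred I) Phi :
  (forall i, i \in r -> P i -> representable (Phi i)) ->
  representable (fun x l => \sum_(i <- r | P i) Phi i x l).
Proof.
elim: r => [|i r IH] rep.
  by apply: eq_representable representable0 => x l _ _; rewrite big_nil.
have {}IH : representable (fun x l => \sum_(i <- r | P i) Phi i x l).
  by apply: IH => j jr; apply: rep; rewrite inE jr orbT.
case Pi : (P i); last first.
  by apply: eq_representable IH => x l _ _; rewrite big_cons Pi.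
apply: eq_representable (representableD (rep i (mem_head i r) Pi) IH) => x l _ _.
by rewrite big_cons Pi.
Qed.

(** An operator on functions on the sphere that multiplies G_l(<., y>) by
    [lam l] and is realized by finite combinations of points. The points
    may depend on [y], the factor may not. *)
Definition multiplier (lam : nat -> R) : Prop :=
  forall y, dot y y = 1 -> representable (fun x l => lam l * (G l).[dot x y]).

(** Composition of operators: each point of a combination is replaced by the
    combination that represents the action of the multiplier on it. *)
Lemma multiplier_representable lam Phi : multiplier lam ->
  representable Phi -> representable (fun x l => lam l * Phi x l).
Proof.
move=> mul_lam [mu mu1 H].
apply: (@eq_representable
  (fun x l => \sum_(z <- mu) z.1 * (lam l * (G l).[dot x z.2]))) => [x l x1 ld|].
  rewrite -H // mulr_sumr; apply: eq_bigr => z _; ring.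
by apply: representable_sum => z /mu1 z1 _; apply/representableZ/mul_lam.
Qed.

Lemma multiplier_poly lam (p : {poly R}) : multiplier lam ->
  multiplier (fun l => p.[lam l]).
Proof.
move=> mul_lam y y1; elim/poly_ind: p => [|p c IH].
  by apply: eq_representable representable0 => x l _ _; rewrite horner0 mul0r.
have := representableD (multiplier_representable mul_lam IH)
          (representableZ c (representable_point y1)).
by apply: eq_representable => x l _ _; rewrite hornerMXaddC; ring.
Qed.

(** The projector onto one eigenspace is the Lagrange interpolation polynomial
    of the operator at its distinct eigenvalues. *)
Lemma multiplier_delta lam k : injective lam -> multiplier lam -> (k <= d)%N ->
  multiplier (fun l => (l == k)%:R).
Proof.
move=> lam_inj mul_lam kd y y1.
have kd1 : (k < d.+1)%N by [].
have := multiplier_poly (tnth (lagrange d.+1 lam) (Ordinal kd1)) mul_lam y1.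
apply: eq_representable => x l _ ld; have ld1 : (l < d.+1)%N by [].
rewrite (lagrange_sample (isT : 0 < d.+1)%N lam_inj (Ordinal kd1) (Ordinal ld1)).
by rewrite -val_eqE eq_sym.
Qed.

(** Minus the second derivative at angle 0 of G_l(<x, y'>), y' being the
    rotation of y in the plane of the coordinates i and j. *)
Lemma representable_rotation i j (y : V) : i != j -> dot y y = 1 ->
  representable (fun x l => let t := dot x y in
    (x 0 i * y 0 i + x 0 j * y 0 j) * (G l)^`().[t] -
    (x 0 j * y 0 i - x 0 i * y 0 j) ^+ 2 * (G l)^`(2).[t]).
Proof.
move=> ij y1.
have [b bE] := interpolate_functional d.+1
  (horner_eval (1 : R) \o deriv) (@node_inj R 0).
pose c s := node R 0 s; pose s_ k := Num.sqrt (1 - c k ^+ 2).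
have cs k : c k ^+ 2 + s_ k ^+ 2 = 1.
  rewrite sqr_sqrtr; first by rewrite addrCA subrr addr0.
  rewrite subr_ge0 expr_le1 // ?(ltW (node_gt0 _ _ _)) //.
  by apply: le_trans (node_le _ _ _) _; rewrite invr1.
have csN k : c k ^+ 2 + (- s_ k) ^+ 2 = 1 by rewrite sqrrN.
have rep k : representable (fun x l =>
   2%:R^-1 * ((G l).[dot x (plane_rotation i j (c k) (s_ k) y)] +
   (G l).[dot x (plane_rotation i j (c k) (- s_ k) y)])).
  by apply/representableZ/representableD; apply: representable_point;
    apply: plane_rotation_unit.
have := @representable_sum _ (index_enum 'I_d.+1) xpredT _
   (fun k _ _ => representableZ (b k) (rep k)).
apply: eq_representable => x l x1 ld /=.
have sz : (size (G l) <= d.+1)%N by apply: leq_trans (size_gegenbauer _ _ _) _.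
have [[p q] /= [sp _ E _ <-]] := rotation_decomp
  (x 0 i * y 0 i + x 0 j * y 0 j) (x 0 j * y 0 i - x 0 i * y 0 j) (dot x y) sz.
have /= := bE p sp; rewrite /horner_eval => ->.
apply: eq_bigr => k _; congr (_ * _).
rewrite !dot_plane_rotation !E // -/(c k) mulNr.
by field.
Qed.

(** Adding up [representable_rotation] over all coordinate planes gives minus
    the Laplacian, because |x|^2 |y|^2 - <x, y>^2 is the sum over the planes of
    (x_j y_i - x_i y_j)^2; the differential equation gives the eigenvalue. *)
Lemma multiplier_laplacian : multiplier (fun l => (l * (l + N))%:R).
Proof.
move=> y y1.
have := @representable_sum _ (index_enum ('I_N.+2 * 'I_N.+2)%type)
  (fun ij => ij.1 != ij.2) _ (fun ij _ Hij => representable_rotation Hij y1).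
move/(representableZ 2%:R^-1).
apply: eq_representable => x l x1 ld /=.
set t := dot x y.
have /(congr1 (fun p => p.[t])) := gegenbauer_ode R N l.
move: (G l) => g.
rewrite -polyC_natr -[(l * _)%:R]polyC_natr -polyCN.
rewrite !(hornerD, hornerN, hornerM, hornerC, hornerX, hornerXn) => ode.
apply: (@mulfI _ 2%:R); first by rewrite pnatr_eq0.
rewrite mulrA divff ?pnatr_eq0 // mul1r.
set D1 := g^`().[t]; set D2 := g^`(2).[t].
pose H (i j : 'I_N.+2) := (x 0 i * y 0 i + x 0 j * y 0 j) * D1 -
    (x 0 j * y 0 i - x 0 i * y 0 j) ^+ 2 * D2.
(* Each plane is counted twice. The diagonal terms are added and removed: they
   are no rotations, but complete the sums to products. *)
have -> : \sum_(ij : 'I_N.+2 * 'I_N.+2 | ij.1 != ij.2) H ij.1 ij.2 =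
  \sum_i \sum_j H i j - \sum_i H i i.
  rewrite pair_big /= [in RHS](bigID (fun ij : 'I_N.+2 * 'I_N.+2 => ij.1 != ij.2)) /=.
  rewrite [X in _ + X - _](_ : _ = \sum_i H i i) ?addrK //.
  rewrite [RHS](eq_bigr (fun i => \sum_(j | j == i) H i j)); last first.
    by move=> i _; rewrite big_pred1_eq.
  rewrite pair_big_dep /=; apply: eq_bigl => ij.
  by rewrite negbK eq_sym.
have S1 : \sum_i x 0 i * y 0 i = t by [].
have Sx : \sum_i x 0 i ^+ 2 = 1 by rewrite -x1; apply: eq_bigr => i _; rewrite expr2.
have Sy : \sum_i y 0 i ^+ 2 = 1 by rewrite -y1; apply: eq_bigr => i _; rewrite expr2.
have -> : \sum_i H i i = 2%:R * t * D1.
  rewrite -S1 mulr_sumr mulr_suml; apply: eq_bigr => i _; rewrite /H; ring.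
have Hin i : \sum_j H i j =
   (x 0 i * y 0 i) * (N.+2%:R * D1 + 2%:R * t * D2) + t * D1 -
   y 0 i ^+ 2 * D2 - x 0 i ^+ 2 * D2.
  rewrite (eq_bigr (fun j => x 0 i * y 0 i * D1 + x 0 j * y 0 j * D1
     - x 0 j ^+ 2 * (y 0 i ^+ 2 * D2) - y 0 j ^+ 2 * (x 0 i ^+ 2 * D2)
     + x 0 j * y 0 j * (2%:R * (x 0 i * y 0 i) * D2))); last first.
    by move=> j _; rewrite /H; ring.
  rewrite !big_split /= !sumrN -!mulr_suml S1 Sx Sy.
  rewrite sumr_const card_ord -mulr_natl; ring.
rewrite (eq_bigr _ (fun i _ => Hin i)) !big_split /= !sumrN -!mulr_suml S1 Sx Sy.
have -> : (l * (l + N))%:R * g.[t] = N.+1%:R * t * D1 - (1 - t ^+ 2) * D2.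
  by apply: oppr_inj; rewrite -mulNr -ode opprB.
rewrite sumr_const card_ord; ring.
Qed.

(** Apply the projector of degree [k] at any point w of the sphere. Pairing its
    combination with itself uses the projector twice: first in the second
    variable, then, G_l being evaluated at a symmetric argument, in the first;
    what is left is G_k(<w, w>) = G_k(1) = 1. *)
Lemma spherical_projector k : (k <= d)%N ->
  exists2 mu, on_sphere mu & forall l, (l <= d)%N ->
    \sum_(z <- mu) \sum_(z' <- mu) z.1 * z'.1 * (G l).[dot z.2 z'.2] = (l == k)%:R.
Proof.
move=> kd; pose w : V := delta_mx 0 0.
have w1 : dot w w = 1 by rewrite dot_delta mxE !eqxx.
have eig_inj : injective (fun l => (l * (l + N))%:R : R).
  by move=> l l' /eqP; rewrite eqr_nat => /eqP; nia.
have [mu mu1 H] := multiplier_delta eig_inj multiplier_laplacian kd w1.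
exists mu => // l ld.
transitivity (\sum_(z <- mu) (l == k)%:R * (z.1 * (G l).[dot w z.2])).
  apply: eq_big_seq => z zmu; rewrite mulrCA dotC -(H _ l (mu1 z zmu) ld) mulr_sumr.
  by apply: eq_bigr => z' _; rewrite mulrA.
rewrite -mulr_sumr [X in _ * X](H _ l w1 ld) w1 gegenbauer_at1 mulr1.
by case: (l == k); rewrite ?mulr0 ?mulr1.
Qed.

End SphereCombinations.

(** * Triangular families of polynomials *)

Section TriangularBasis.

Variables (S : comNzRingType) (g : nat -> {poly S}) (w : nat -> S).
Hypothesis size_g : forall k, (size (g k) <= k.+1)%N.
Hypothesis lead_g : forall k, w k * (g k)`_k = 1.

Lemma triangular_span n (p : {poly S}) : (size p <= n)%N ->
  exists f : nat -> S, p = \sum_(k < n) f k *: g k.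
Proof.
elim: n p => [|n IH] p sp.
  exists (fun=> 0); rewrite big_ord0; apply/eqP.
  by rewrite -size_poly_leq0.
pose c := p`_n * w n.
have [|f fE] := IH (p - c *: g n).
  apply/leq_sizeP => j; rewrite leq_eqVlt coefB coefZ => /orP[/eqP<-|nj].
    by rewrite /c -mulrA lead_g mulr1 subrr.
  by rewrite !nth_default ?mulr0 ?subrr //; apply: leq_trans nj.
exists (fun k => if k == n then c else f k).
rewrite big_ord_recr /= eqxx -[LHS](subrK (c *: g n)) fE; congr (_ + _).
by apply: eq_bigr => k _; rewrite ltn_eqF.
Qed.

Lemma triangular_free n (f : nat -> S) :
  \sum_(k < n) f k *: g k = 0 -> forall k, (k < n)%N -> f k = 0.
Proof.
elim: n => [//|n IH] /[dup] E0.
rewrite big_ord_recr /= => E.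
have fn : f n = 0.
  have /(congr1 (fun p : {poly S} => w n * p`_n)) := E.
  rewrite coefD coefZ coef0 mulr0 coef_sum big1 => [|k _].
    by rewrite add0r mulrCA lead_g mulr1.
  by rewrite coefZ nth_default ?mulr0 // (leq_trans (size_g _)).
move=> k; rewrite ltnS leq_eqVlt => /orP[/eqP->//|]; apply: IH.
by rewrite fn scale0r addr0 in E.
Qed.

End TriangularBasis.

(** * Expansion in multivariate Gegenbauer polynomials *)

Section Homogenization.

Variable S : comNzRingType.

(** For c the coefficients of a polynomial p with the parity of k, this is
    b^(k/2) p((X - a) / sqrt b), with no square root and no division. *)
Definition homogenize (c : nat -> S) (a b : S) (k : nat) : {poly S} :=
  \sum_(j < (k./2).+1)
    (c (k - j.*2)%N *: ('X - a%:P) ^+ (k - j.*2)) * (b ^+ j)%:P.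

Lemma eq_homogenize c c' a b k : c =1 c' -> homogenize c a b k = homogenize c' a b k.
Proof. by move=> cc'; apply: eq_bigr => j _; rewrite cc'. Qed.

Lemma size_homogenize c a b k : (size (homogenize c a b k) <= k.+1)%N.
Proof.
apply: leq_trans (size_sum _ _ _) _; apply/bigmax_leqP => j _.
rewrite mulrC mul_polyC; apply: leq_trans (size_scale_leq _ _) _.
apply: leq_trans (size_scale_leq _ _) _.
by rewrite size_exp_XsubC ltnS leq_subr.
Qed.

Lemma coef_homogenize c a b k : (homogenize c a b k)`_k = c k.
Proof.
rewrite /homogenize big_ord_recl coefD [X in _ + X]coef_sum big1 => [|j _].
  rewrite addr0 double0 subn0 expr0 mulr1 coefZ.
  have /monicP := monic_exp k (monicXsubC a).
  by rewrite lead_coefE size_exp_XsubC /= => ->; rewrite mulr1.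
rewrite mulrC mul_polyC !coefZ nth_default ?mulr0 // size_exp_XsubC.
by rewrite /bump; case: k j => [[[]//]|k j];
  rewrite ?doubleS ?subSS ltnS ?leq_subr //; lia.
Qed.

End Homogenization.

Lemma map_homogenize (S T : comNzRingType) (h : {rmorphism S -> T}) c a b k :
  map_poly h (homogenize c a b k) = homogenize (fun i => h (c i)) (h a) (h b) k.
Proof.
rewrite rmorph_sum; apply: eq_bigr => j _ /=.
rewrite rmorphM /= map_polyC /= map_polyZ /= !rmorphXn /= rmorphB /=.
by rewrite map_polyX map_polyC.
Qed.

Lemma sum_same_parity (V : zmodType) (h : nat -> V) (k : nat) :
  (forall i, odd (k + i) -> h i = 0) ->
  \sum_(i < k.+1) h i = \sum_(j < k./2.+1) h (k - j.*2)%N.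
Proof.
suff [] : ((forall i, odd (k + i) -> h i = 0) ->
    \sum_(i < k.+1) h i = \sum_(j < k./2.+1) h (k - j.*2)%N) /\
  ((forall i, odd (k.+1 + i) -> h i = 0) ->
    \sum_(i < k.+2) h i = \sum_(j < k.+1./2.+1) h (k.+1 - j.*2)%N) by [].
elim: k => [|k [IH0 IH1]].
  split=> h0; rewrite ?big_ord_recr !big_ord0 /= ?big_ord_recr ?big_ord0 //=.
  by rewrite h0 // add0r.
split=> // h0; rewrite big_ord_recr big_ord_recr /= [in RHS]big_ord_recl /= subn0.
rewrite (h0 k.+1); last by rewrite addSn /= negbK addnS addnn /= odd_double.
rewrite addr0 addrC -IH0; last by move=> i ki; rewrite h0 // !addSn /= negbK.
by [].
Qed.

Section MultivariateGegenbauer.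

Variable R : realType.

(** Parity of the Gegenbauer polynomials is what makes the truncated sum over
    the exponents k - 2j the whole polynomial. *)
Lemma homogenize_gegenbauer (N k : nat) (a r s : R) :
  (homogenize (fun i => (gegenbauer R N.+2 k)`_i) a (r ^+ 2) k).[a + r * s] =
  r ^+ k * (gegenbauer R N.+2 k).[s].
Proof.
rewrite [in RHS](@horner_coef_wide _ k.+1) ?size_gegenbauer //.
rewrite (@sum_same_parity _ (fun i => (gegenbauer R N.+2 k)`_i * s ^+ i)); last first.
  by move=> i /gegenbauer_parity ->; rewrite mul0r.
rewrite mulr_sumr horner_sum; apply: eq_bigr => j _.
rewrite hornerM hornerZ horner_exp hornerXsubC hornerC addrAC subrr add0r.
rewrite -exprM exprMn mul2n.
have -> : r ^+ k = r ^+ (k - j.*2) * r ^+ j.*2.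
  rewrite -exprD subnK //; have := ltn_ord j; rewrite ltnS -leq_double => /leq_trans.
  by apply; rewrite -[leqRHS]odd_double_half leq_addl.
ring.
Qed.

Variable m : nat.
Implicit Types (u v : 'rV[R]_m).

Definition uvpoint u v (i : 'I_(m + m)) : R := row_mx u v 0 i.

Lemma tueval_meval (F : {poly {mpoly R[m + m]}}) t u v :
  tueval F t u v = (map_poly (meval (uvpoint u v)) F).[t].
Proof. by []. Qed.

Lemma meval_uvar u v i : (uvar R i).@[uvpoint u v] = u 0 i.
Proof. by rewrite mevalXU /uvpoint row_mxEl. Qed.

Lemma meval_vvar u v i : (vvar R i).@[uvpoint u v] = v 0 i.
Proof. by rewrite mevalXU /uvpoint row_mxEr. Qed.

Lemma mgegenbauerE n k : mgegenbauer R n m k =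
  homogenize (fun i => ((gegenbauer R (n - m) k)`_i)%:MP_[m + m]) (uv R m)
     ((1 - uu R m) * (1 - vv R m)) k.
Proof. by []. Qed.

Lemma map_mgegenbauer n k u v :
  map_poly (meval (uvpoint u v)) (mgegenbauer R n m k) =
  homogenize (fun i => (gegenbauer R (n - m) k)`_i) (dot u v)
     ((1 - dot u u) * (1 - dot v v)) k.
Proof.
rewrite mgegenbauerE map_homogenize /uv /uu /vv /=.
rewrite rmorphM !rmorphB !rmorph1 !rmorph_sum /=.
rewrite (eq_homogenize _ _ _ (fun i => mevalC _ _)).
congr (homogenize _ _ ((1 - _) * (1 - _)) _).
- by apply: eq_bigr => i _; rewrite rmorphM /= meval_uvar meval_vvar.
- by apply: eq_bigr => i _; rewrite rmorphXn /= meval_uvar expr2.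
- by apply: eq_bigr => i _; rewrite rmorphXn /= meval_vvar expr2.
Qed.

(** In t the polynomial G_k^(n,m) has degree k, and its leading coefficient is
    that of G_k^(n-m), a nonzero real number; so no division by a polynomial in
    u, v occurs. *)
Lemma mgegenbauer_expansion N (F : {poly {mpoly R[m + m]}}) d :
  (size F <= d)%N ->
  exists f : nat -> {mpoly R[m + m]},
    F = \sum_(k < d) (f k)%:P * mgegenbauer R (m + N.+2) m k.
Proof.
move=> sF; have sz k : (size (mgegenbauer R (m + N.+2) m k) <= k.+1)%N.
  by rewrite mgegenbauerE; exact: size_homogenize.
have [|f ->] := triangular_span
  (w := fun k => ((gegenbauer R N.+2 k)`_k)^-1%:MP_[m + m]) sz _ sF.
  move=> k; rewrite mgegenbauerE coef_homogenize addKn -mpolyCM mulVf //.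
  exact: coef_gegenbauer_neq0.
by exists f; apply: eq_bigr => k _; rewrite mul_polyC.
Qed.

Lemma horner_ext (p q : {poly R}) : (forall t, p.[t] = q.[t]) -> p = q.
Proof.
move=> pq; apply/eqP; rewrite -subr_eq0; apply/eqP.
have c_inj := @node_inj R 0.
rewrite (lagrange_gen (ltn0Sn (size (p - q))) c_inj (leqnSn _)) big1 // => i _.
by rewrite hornerD hornerN pq subrr mul0r.
Qed.

(** G_k^(n,m) is symmetric in u, v, so at fixed u, v the two values of f_k
    are coefficients of one polynomial in t on the same triangular basis. *)
Lemma expansion_sym N F d (f : nat -> {mpoly R[m + m]}) :
  (forall t u v, tueval F t u v = tueval F t v u) ->
  F = \sum_(k < d) (f k)%:P * mgegenbauer R (m + N.+2) m k ->
  forall k u v, (k < d)%N -> ueval (f k) u v = ueval (f k) v u.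
Proof.
move=> Fsym FE k u v kd; apply/eqP; rewrite -subr_eq0; apply/eqP.
pose g k := homogenize (fun i => (gegenbauer R N.+2 k)`_i) (dot u v)
     ((1 - dot u u) * (1 - dot v v)) k.
apply: (@triangular_free _ g (fun k => ((gegenbauer R N.+2 k)`_k)^-1) _ _ d
  (fun k => ueval (f k) u v - ueval (f k) v u)) => //.
- by move=> j; exact: size_homogenize.
- by move=> j; rewrite coef_homogenize mulVf // coef_gegenbauer_neq0.
have gE j : map_poly (meval (uvpoint u v)) (mgegenbauer R (m + N.+2) m j) = g j.
  by rewrite map_mgegenbauer addKn.
have gE' j : map_poly (meval (uvpoint v u)) (mgegenbauer R (m + N.+2) m j) = g j.
  by rewrite map_mgegenbauer addKn /g (dotC v u) (mulrC (1 - dot v v)).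
transitivity (map_poly (meval (uvpoint u v)) F - map_poly (meval (uvpoint v u)) F).
  rewrite FE !rmorph_sum -sumrB; apply: eq_bigr => j _ /=.
  by rewrite !rmorphM /= !map_polyC /= gE gE' !mul_polyC scalerBl.
by apply/eqP; rewrite subr_eq0; apply/eqP/horner_ext => t; exact: Fsym.
Qed.

Lemma tueval_expansion N F d (f : nat -> {mpoly R[m + m]}) u v (r r' s : R) :
  F = \sum_(k < d) (f k)%:P * mgegenbauer R (m + N.+2) m k ->
  r ^+ 2 = 1 - dot u u -> r' ^+ 2 = 1 - dot v v ->
  tueval F (dot u v + r * r' * s) u v =
  \sum_(k < d) ueval (f k) u v * (r * r') ^+ k * (gegenbauer R N.+2 k).[s].
Proof.
move=> -> ru rv; rewrite tueval_meval rmorph_sum horner_sum.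
apply: eq_bigr => k _ /=.
rewrite rmorphM /= map_polyC /= hornerM hornerC map_mgegenbauer addKn.
by rewrite -ru -rv -exprMn homogenize_gegenbauer mulrA.
Qed.

End MultivariateGegenbauer.

(** * From positive semidefinite kernels to positive semidefinite matrices *)

Section GramForm.

Variables (R : realType) (m : nat).
Local Notation idx d := 'I_#|{: 'X_{1..m < d.+1}}|.
Implicit Types (u v : 'rV[R]_m).

Definition zvec d u (i : idx d) : R := zmon d (fun k => u 0 k) 0 i.

Lemma ueval_gram d (H : 'M[R]_#|{: 'X_{1..m < d.+1}}|) u v :
  ueval (\sum_i \sum_j H i j *: Zmx R m d i j) u v =
  \sum_i \sum_j H i j * (zvec u i * zvec v j).
Proof.
rewrite /ueval -/(uvpoint u v) rmorph_sum; apply: eq_bigr => i _.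
rewrite rmorph_sum; apply: eq_bigr => j _ /=; rewrite mevalZ.
rewrite !mxE big_ord1 !mxE mevalM; congr (_ * (_ * _)).
  rewrite /zvec !mxE rmorph_prod; apply: eq_bigr => k _.
  by rewrite rmorphXn /= meval_uvar.
rewrite /zvec !mxE rmorph_prod; apply: eq_bigr => k _.
by rewrite rmorphXn /= meval_vvar.
Qed.

(** Each monomial in (u, v) is a product of a monomial in u and one in v, that
    is, an entry of [Zmx]. *)
Lemma gram_form_exists (f : {mpoly R[m + m]}) :
  exists (d : nat) (H : 'M[R]_#|{: 'X_{1..m < d.+1}}|),
    f = \sum_i \sum_j H i j *: Zmx R m d i j.
Proof.
pose d := msize f; exists d.
have split_mon (a : 'X_{1..(m + m)%N < d}) : exists ij : idx d * idx d,
    'X_[a] = Zmx R m d ij.1 ij.2.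
  pose l := [multinom a (lshift m i) | i < m].
  pose r := [multinom a (rshift m i) | i < m].
  have mE : (mdeg l + mdeg r)%N = mdeg a.
    rewrite !mdegE big_split_ord /=.
    by congr (_ + _)%N; apply: eq_bigr => i _; rewrite mnmE.
  have ld : (mdeg l < d.+1)%N.
    by rewrite ltnS (leq_trans _ (ltnW (bmdeg a))) // -mE leq_addr.
  have rd : (mdeg r < d.+1)%N.
    by rewrite ltnS (leq_trans _ (ltnW (bmdeg a))) // -mE leq_addl.
  exists (enum_rank (BMultinom ld), enum_rank (BMultinom rd)).
  rewrite !mxE big_ord1 !mxE !enum_rankK /= mpolyXE_id big_split_ord /=.
  by congr (_ * _); apply: eq_bigr => i _; rewrite mnmE.
have [ij ijE] := fin_all_exists split_mon.
exists (\matrix_(i, j) \sum_(a : 'X_{1..(m + m)%N < d} | ij a == (i, j)) f@_a).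
rewrite {1}(mpolywE (leqnn (msize f))) pair_big /=.
rewrite (partition_big ij xpredT) //=; apply: eq_bigr => -[i j] _.
rewrite mxE scaler_suml; apply: eq_bigr => a /eqP aij.
by rewrite ijE aij.
Qed.

(** The coefficient functionals in one variable are combinations of values at
    the nodes; in m variables their tensor products are combinations of values
    on the grid of m-tuples of nodes. *)
Lemma dual_grid d : exists (T : finType) (p : T -> 'rV[R]_m) (w : idx d -> T -> R),
  (forall s, dot (p s) (p s) < 1) /\
  forall i j, \sum_s w i s * zvec (p s) j = (i == j)%:R.
Proof.
have c_inj := @node_inj R m.
have [b bE] := fin_all_exists (fun e : 'I_d.+1 =>
  interpolate_functional d.+1 (coefp e : {scalar {poly R}}) c_inj).
exists {ffun 'I_m -> 'I_d.+1},
  (fun s : {ffun 'I_m -> 'I_d.+1} => \row_k node R m (s k)),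
  (fun i (s : {ffun 'I_m -> 'I_d.+1}) =>
     \prod_k b (inord ((enum_val i : 'X_{1..m < d.+1}) k)) (s k)).
split=> [s|i j].
  have le1 : dot (\row_k node R m (s k)) (\row_k node R m (s k)) <=
     \sum_(k < m) (m.+1%:R ^-1) ^+ 2.
    apply: ler_sum => k _; rewrite !mxE -expr2 lerXn2r ?nnegrE ?invr_ge0 ?ler0n //.
      exact: node_le.
  apply: le_lt_trans le1 _; rewrite sumr_const card_ord exprVn -[_ *+ m]mulr_natr.
  rewrite ltr_pdivrMl ?exprn_gt0 ?ltr0n // mulr1 -natrX ltr_nat.
  by rewrite expnS expn1; lia.
set a := (enum_val i : 'X_{1..m < d.+1}); set a' := (enum_val j : 'X_{1..m < d.+1}).
have le_deg (c : 'X_{1..m < d.+1}) k : (c k < d.+1)%N.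
  apply: leq_ltn_trans (bmdeg c).
  by rewrite mdegE (bigD1 k) //= leq_addr.
transitivity (\prod_k \sum_(s < d.+1) b (inord (a k)) s * node R m s ^+ a' k).
  rewrite bigA_distr_bigA; apply: eq_bigr => s _.
  by rewrite /zvec mxE -big_split; apply: eq_bigr => k _; rewrite mxE.
transitivity (\prod_k ((a k == a' k)%:R : R)).
  apply: eq_bigr => k _; have := bE (inord (a k)) 'X^(a' k).
  rewrite size_polyXn /= coefXn inordK ?le_deg // => -> //.
  by apply: eq_bigr => s _; rewrite hornerXn.
case: eqVneq => [ij|ij]; first by rewrite big1 // => k _; rewrite /a /a' ij eqxx.
have /existsP[k /negPf nk] : [exists k, a k != a' k].
  rewrite -negb_forall; apply: contra ij => /forallP aa'.
  apply/eqP/enum_val_inj/val_inj/mnmP => k; exact/eqP/aa'.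
by rewrite (bigD1 k) //= nk mul0r.
Qed.

(** Points are listed with their weights, and may be repeated. *)
Definition psd_on_ball (K : 'rV[R]_m -> 'rV[R]_m -> R) : Prop :=
  forall nu : seq (R * 'rV[R]_m), (forall z, z \in nu -> dot z.2 z.2 < 1) ->
    0 <= \sum_(z <- nu) \sum_(z' <- nu) z.1 * z'.1 * K z.2 z'.2.

(** The dual grid writes [H] as W K W^T, where K is the matrix of the values of
    [f] at the grid points and W that of the dual weights. *)
Lemma psd_poly_of_kernel (f : {mpoly R[m + m]}) :
  (forall u v, ueval f u v = ueval f v u) -> psd_on_ball (ueval f) ->
  psd_poly f.
Proof.
move=> fsym fpsd; split=> //.
have [d [H fE]] := gram_form_exists f; exists d, H; split=> //.
have [T [p [w [p1 wE]]]] := dual_grid d.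
have HE i j : H i j = \sum_s \sum_s' w i s * w j s' * ueval f (p s) (p s').
  transitivity (\sum_s \sum_s' \sum_i' \sum_j'
      H i' j' * ((w i s * zvec (p s) i') * (w j s' * zvec (p s') j'))); last first.
    apply: eq_bigr => s _; apply: eq_bigr => s' _.
    rewrite fE ueval_gram mulr_sumr; apply: eq_bigr => i' _.
    rewrite mulr_sumr; apply: eq_bigr => j' _; ring.
  transitivity (\sum_i' \sum_j' H i' j' * ((i == i')%:R * (j == j')%:R)).
    rewrite (bigD1 i) //= [X in _ + X]big1 ?addr0 => [|i' ii']; last first.
      by rewrite big1 // => j' _; rewrite eq_sym (negPf ii') mul0r mulr0.
    rewrite (bigD1 j) //= big1 ?addr0 => [|j' jj'].
      by rewrite !eqxx !mulr1.
    by rewrite (eq_sym j) (negPf jj') !mulr0.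
  under [RHS]eq_bigr => s _ do rewrite exchange_big /=.
  rewrite [RHS]exchange_big /=; apply: eq_bigr => i' _.
  under [RHS]eq_bigr => s _ do rewrite exchange_big /=.
  rewrite [RHS]exchange_big /=; apply: eq_bigr => j' _.
  rewrite -!wE mulr_suml mulr_sumr; apply: eq_bigr => s _.
  by rewrite mulr_sumr mulr_sumr.
split.
  apply/matrixP => i j; rewrite mxE !HE exchange_big /=.
  by apply: eq_bigr => s _; apply: eq_bigr => s' _; rewrite fsym; ring.
move=> x.
pose c s := \sum_i x 0 i * w i s.
have -> : (x *m H *m x^T) 0 0 =
  \sum_(s : T) \sum_(s' : T) c s * c s' * ueval f (p s) (p s').
  rewrite mxE.
  transitivity (\sum_j \sum_i \sum_s \sum_s'
     (x 0 i * w i s) * (x 0 j * w j s') * ueval f (p s) (p s')).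
    apply: eq_bigr => j _; rewrite !mxE mulr_suml; apply: eq_bigr => i _.
    rewrite HE mulr_sumr mulr_suml; apply: eq_bigr => s _.
    rewrite mulr_sumr mulr_suml; apply: eq_bigr => s' _; ring.
  under eq_bigr => j _ do rewrite exchange_big /=.
  rewrite exchange_big /=; apply: eq_bigr => s _.
  under eq_bigr => j _ do rewrite exchange_big /=.
  rewrite exchange_big /=; apply: eq_bigr => s' _.
  rewrite exchange_big /= /c !mulr_suml; apply: eq_bigr => i _.
  by rewrite mulr_sumr mulr_suml.
have : 0 <= _ := fpsd [seq (c s, p s) | s <- index_enum T] _.
rewrite big_map; under eq_bigr => s _ do rewrite big_map.
by apply=> _ /mapP[s _ ->] /=.
Qed.

End GramForm.

(** * The coefficients of the expansion *)

Section Embedding.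

Variables (R : realType) (n : nat) (e : 'I_n -> 'rV[R]_n).

Lemma dot_mulmx (x y : 'rV[R]_n) : dot x y = (x *m y^T) 0 0.
Proof. by rewrite mxE; apply: eq_bigr => i _; rewrite mxE. Qed.

Definition lincomb (w : 'rV[R]_n) : 'rV[R]_n := w *m \matrix_(i < n) e i.

Hypothesis orth_e : forall i j, dot (e i) (e j) = (i == j)%:R.

Lemma dot_lincomb (w w' : 'rV[R]_n) : dot (lincomb w) (lincomb w') = dot w w'.
Proof.
rewrite !dot_mulmx trmx_mul mulmxA -(mulmxA w).
rewrite [X in w *m X *m _](_ : _ = 1%:M) ?mulmx1 //.
apply/matrixP => i j; rewrite [RHS]mxE -orth_e mxE.
by apply: eq_bigr => k _; rewrite !mxE.
Qed.

Lemma dot_lincomb_basis w i : dot (lincomb w) (e i) = w 0 i.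
Proof.
have -> : e i = lincomb (delta_mx 0 i) by rewrite /lincomb -rowE rowK.
by rewrite dot_lincomb dot_delta.
Qed.

End Embedding.

Lemma dot_row_mx (R : realType) (m n : nat) (u u' : 'rV[R]_m) (y y' : 'rV[R]_n) :
  dot (row_mx u y) (row_mx u' y') = dot u u' + dot y y'.
Proof.
rewrite /dot big_split_ord /=; congr (_ + _); apply: eq_bigr => i _.
  by rewrite !row_mxEl.
by rewrite !row_mxEr.
Qed.

Lemma PD_seq (R : realType) (n m : nat) (q : 'I_m -> 'rV[R]_n)
    (F : R -> 'rV[R]_m -> 'rV[R]_m -> R) (s : seq (R * 'rV[R]_n)) :
  PD q F -> (forall z, z \in s -> dot z.2 z.2 = 1) ->
  0 <= \sum_(z <- s) \sum_(z' <- s) z.1 * z'.1 *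
    F (dot z.2 z'.2) (\row_k dot z.2 (q k)) (\row_k dot z'.2 (q k)).
Proof.
move=> [_ _ psdF] s1.
pose z i := tnth (in_tuple s) i.
have z1 i : enorm (z i).2 = 1 by rewrite /enorm s1 ?sqrtr1 // mem_tnth.
have [_ /(_ (\row_i (z i).1))] := psdF _ (fun i => (z i).2) z1.
congr (0 <= _); rewrite mxE [RHS]exchange_big [RHS]big_tnth /=.
apply: eq_bigr => j _; rewrite !mxE mulr_suml [RHS]big_tnth.
by apply: eq_bigr => i _; rewrite !mxE mulrAC.
Qed.

(** The points used are (u, r y), expressed in the basis [e], for u in [nu] and
    y in the combination [mu] that projects onto degree [k]. The weight r^-k
    cancels the factor (r r')^k of the expansion. *)
Lemma coefficient_psd (R : realType) (m N d : nat)
    (e : 'I_(m + N.+2) -> 'rV[R]_(m + N.+2))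
    (F : {poly {mpoly R[m + m]}}) (f : nat -> {mpoly R[m + m]}) (k : nat) :
  (forall i j, dot (e i) (e j) = (i == j)%:R) ->
  PD (fun i => e (lshift N.+2 i)) (tueval F) ->
  F = \sum_(k < d) (f k)%:P * mgegenbauer R (m + N.+2) m k ->
  (k < d)%N -> psd_on_ball (ueval (f k)).
Proof.
move=> orth_e hF FE kd nu nu1.
have [mu mu1 muE] := @spherical_projector R N d k (ltnW kd).
pose r (u : 'rV[R]_m) := Num.sqrt (1 - dot u u).
pose pt (u : 'rV[R]_m) (y : 'rV[R]_N.+2) := lincomb e (row_mx u (r u *: y)).
have r_sq z : z \in nu -> r z.2 ^+ 2 = 1 - dot z.2 z.2.
  by move=> /nu1 z1; rewrite sqr_sqrtr // subr_ge0 ltW.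
have r_neq0 z : z \in nu -> r z.2 != 0.
  by move=> /nu1 z1; rewrite sqrtr_eq0 -ltNge subr_gt0.
have dot_pt u u' y y' : dot (pt u y) (pt u' y') = dot u u' + r u * r u' * dot y y'.
  by rewrite dot_lincomb // dot_row_mx dotZl dotZr mulrA.
have coord_pt u y : \row_i dot (pt u y) (e (lshift N.+2 i)) = u.
  by apply/rowP => i; rewrite mxE dot_lincomb_basis // row_mxEl.
pose s := [seq (z.1 * (r z.2) ^- k * y.1, pt z.2 y.2) | z <- nu, y <- mu].
have s1 z : z \in s -> dot z.2 z.2 = 1.
  move: z => _ /allpairsP[[z y] /= [znu ymu ->]] /=.
  by rewrite dot_pt (mu1 y ymu) mulr1 -expr2 r_sq // addrC subrK.
have := PD_seq hF s1; congr (0 <= _).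
rewrite big_allpairs_dep; apply: eq_big_seq => z znu.
under eq_bigr => y _ do rewrite big_allpairs_dep /=.
rewrite exchange_big; apply: eq_big_seq => z' znu' /=.
set u := z.2; set u' := z'.2.
transitivity (\sum_(l < d) z.1 * z'.1 * (r u * r u') ^- k * 
   (ueval (f l) u u' * (r u * r u') ^+ l) *
   \sum_(y <- mu) \sum_(y' <- mu) y.1 * y'.1 * (gegenbauer R N.+2 l).[dot y.2 y'.2]).
  under [RHS]eq_bigr => l _ do rewrite mulr_sumr.
  rewrite [RHS]exchange_big; apply: eq_bigr => y _ /=.
  under [RHS]eq_bigr => l _ do rewrite mulr_sumr.
  rewrite [RHS]exchange_big; apply: eq_bigr => y' _ /=.
  rewrite dot_pt !coord_pt (tueval_expansion (dot y.2 y'.2) FE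
    (r_sq z znu) (r_sq z' znu')).
  rewrite mulr_sumr; apply: eq_bigr => l _.
  have -> : (r u * r u') ^- k = r u ^- k * r u' ^- k by rewrite exprMn invfM.
  rewrite -/u -/u'; move: (r u ^- k) (r u' ^- k) => ? ?; ring.
rewrite (bigD1 (Ordinal kd)) //= [X in _ + X]big1 ?addr0 => [|l lk]; last first.
  rewrite (muE l (ltnW (ltn_ord l))).
  by rewrite -[_ == _]/(l == Ordinal kd) (negPf lk) mulr0.
rewrite (muE _ (ltnW kd)) eqxx mulr1 (mulrC (ueval _ _ _)) mulrA mulfVK //.
by rewrite expf_neq0 // mulf_neq0 ?r_neq0.
Qed.

Theorem theorem3p2 (R : realType) (n m : nat) (hmn : (m.+2 <= n)%N)
    (e : 'I_n -> 'rV[R]_n) (he : orthonormal_basis e)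
    (F : {poly {mpoly R[m + m]}})
    (Fsym : forall (t : R) (u v : 'rV[R]_m), tueval F t u v = tueval F t v u)
    (hF : PD (fun i : 'I_m => e (widen_ord (ltnW (ltnW hmn)) i)) (tueval F)) :
  exists f : 'I_(deg_t F).+1 -> {mpoly R[m + m]},
    (forall k, psd_poly (f k)) /\
    F = \sum_(k < (deg_t F).+1) (f k)%:P * mgegenbauer R n m k.
Proof.
have [N nE] : exists N, n = (m + N.+2)%N.
  by exists (n - m.+2)%N; rewrite addnS addnS -2!addSn subnKC.
subst n; have [_ orth_e] := he.
have {}hF : PD (fun i => e (lshift N.+2 i)) (tueval F).
  congr (PD _ _): hF; apply: boolp.funext => i; congr (e _); exact: val_inj.
have [f FE] := mgegenbauer_expansion N (leqSpred (size F)).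
exists f; split=> // k; apply: psd_poly_of_kernel => [u v|].
  exact: expansion_sym Fsym FE _ _ _ (ltn_ord k).
exact: coefficient_psd orth_e hF FE (ltn_ord k).
Qed.
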